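(* Let $\alpha\in(0,\pi)$, $N\ge2$ and $d=d_N^+$ or $d=d_N^-$. Let $$\Theta=\begin{cases}(\theta_N,\pi-\theta_N)&\text{if }N\text{ is even},\\(\theta_{N-2},\pi-\theta_N)&\text{if }N\text{ is odd and }d_1=1,\\(\theta_N,\pi-\theta_{N-2})&\text{if }N\text{ is odd and }d_1=-1.\end{cases}$$ Then: 1. $W(\,\cdot\,,d)$ admits a minimiser over $A_N$ if $\alpha\in\Theta$; 2. $\inf_{a\in A_N}W(a,d)=-\infty$ if $N\ge3$ and $\alpha\notin\overline\Theta$.
   Context: $d_N^+=(1,-1,1,\dots,\pm1)\in\{\pm1\}^N$ and $d_N^-=(-1,1,-1,\dots,\pm1)\in\{\pm1\}^N$ are the alternating sign vectors starting with $1$ and $-1$, respectively. $\theta_0=\theta_1=\theta_2=0$, and for $N\ge3$, $\theta_N=\arccos\left(\frac{\sqrt{N+1}-1}{N}\right)$ if $N$ is odd, $\theta_N=\arccos\left(\frac{\sqrt N-1}{N-1}\right)$ if $N$ is even. $A_N=\{a\in(-1,1)^N:-1<a_1<\dots<a_N<1\}$. For $a\in A_N$, $d\in\{\pm1\}^N$, put $\gamma_n=d_n-\cos\alpha$ and $$W(a,d)=-\frac\pi2\sum_{n=1}^N\gamma_n^2\log(2-2a_n^2)-\frac\pi2\sum_{n=1}^N\sum_{k\ne n}\gamma_k\gamma_n\log\left(\frac{1+\sqrt{1-\varrho(a_k,a_n)^2}}{\varrho(a_k,a_n)}\right),\quad\varrho(b,c)=\frac{|b-c|}{1-bc}.$$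 *)

(* Defs.v *)
From HB Require Import structures.
From mathcomp Require Import all_boot all_order all_algebra.
From mathcomp Require Import all_classical all_reals all_analysis.
Set Implicit Arguments.
Unset Strict Implicit.
Unset Printing Implicit Defensive.
Import Order.TTheory GRing.Theory Num.Theory.
Import numFieldNormedType.Exports.

Local Open Scope classical_set_scope.
Local Open Scope ring_scope.

                                                                  
                                                              

Definition dplus (R : realType) (N : nat) : 'rV[R]_N :=
  \row_(i < N) (-1) ^+ i.

Definition dminus (R : realType) (N : nat) : 'rV[R]_N :=
  \row_(i < N) (-1) ^+ i.+1.

Definition theta (R : realType) (N : nat) : R :=
  if (N <= 2)%N then 0
  else if odd N then acos ((Num.sqrt (N%:R + 1) - 1) / N%:R)
  else acos ((Num.sqrt N%:R - 1) / (N%:R - 1)).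

Definition config (R : realType) (N : nat) : set 'rV[R]_N :=
  [set a | (forall i, -1 < a 0 i < 1) /\
           (forall i j : 'I_N, (i < j)%N -> a 0 i < a 0 j)].
Arguments config R N : clear implicits.

Definition rho (R : realType) (b c : R) : R := `|b - c| / (1 - b * c).

Definition gamma (R : realType) (N : nat) (alpha : R) (d : 'rV[R]_N)
    (n : 'I_N) : R :=
  d 0 n - cos alpha.

Definition W (R : realType) (N : nat) (alpha : R) (a d : 'rV[R]_N) : R :=
  - (pi / 2) * (\sum_(n < N) gamma alpha d n ^+ 2 * ln (2 - 2 * a 0 n ^+ 2))
  - (pi / 2) * (\sum_(n < N) \sum_(k < N | k != n)
      gamma alpha d k * gamma alpha d n *
      ln ((1 + Num.sqrt (1 - rho (a 0 k) (a 0 n) ^+ 2))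
          / rho (a 0 k) (a 0 n))).

                                                                      
Definition Theta (R : realType) (N : nat) (d1 : R) : set R :=
  if ~~ odd N then `]theta R N, pi - theta R N[%classic
  else if d1 == 1 then `]theta R (N - 2)%N, pi - theta R N[%classic
  else `]theta R N, pi - theta R (N - 2)%N[%classic.

(* Main.v *)
Require Import Defs.
From HB Require Import structures.
From mathcomp Require Import all_boot all_order all_algebra.
From mathcomp Require Import all_classical all_reals all_analysis.
From mathcomp Require Import ring lra zify.
Import Order.TTheory GRing.Theory Num.Theory.
Import numFieldNormedType.Exports.

Local Open Scope classical_set_scope.
Local Open Scope ring_scope.

(** [rho] is the pseudo-hyperbolic distance on (-1,1), that is
tanh |s - t| in the coordinates b = tanh s, c = tanh t, and the interaction of
two walls differs from - ln (rho b c) by at most ln 2.  Hence, if the walls of a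
block i <= k < j of neighbours approach each other at a common scale eps while
everything else stays apart, the energy changes by - pi * S * ln (1 / eps) up to
a bounded error, where S is the sum of gamma_k * gamma_l over the pairs k < l of
the block.  The sign of S on the blocks decides everything.

With c = cos alpha and alternating signs, [block_charge] gives
2 S = m ((m - 1) c^2 - 1) for a block of even length m, and
2 S = (m - 1) (m c^2 - 2 s c - 1) for a block of odd length m whose first sign
is s.  Writing r^2 = m + 1, the second factor is
((r - 1) s c - 1) ((r + 1) s c + 1), so that its sign changes at
s c = - 1 / (r + 1) and at 1 / (r - 1).  The former matters, and
1 / (r + 1) = (sqrt (m + 1) - 1) / m is cos theta_m for odd m > 2.  Short blocks
give weaker constraints than long ones, and even blocks weaker ones than odd
blocks.  For even N > 2 the binding blocks are the two of length N - 1, one for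
each first sign.  For odd N they are the whole configuration, whose first sign
is d_1, and, if N > 3, the block of length N - 2 at index 1, whose first sign is
- d_1.  So all blocks of at least two walls have S < 0 if alpha is in Theta
([window_stable]), and some block has S > 0 if alpha is outside its closure
([window_unstable]).

If S > 0 on a block, squeezing that block sends the energy to minus infinity
([energy_unbounded]).  If S < 0 on all blocks, several groups of walls may still
collapse at unrelated scales.  Cutting a block at its widest gap makes all pairs
across the cut interact, up to a bounded error, with the strength of that gap,
and this yields by recursion an upper bound of the pair sum that tends to minus
infinity when any gap closes ([cluster_bound]).  The self-energies bound the
walls away from -1 and 1, because gamma_k is never 0.  Sublevel sets of W
therefore lie in compact subsets of the configuration space
([sublevel_margin]), on which W is continuous and attains its minimum. *)

(** * Pair sums over blocks of consecutive indices *)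

Definition pairsum {V : nmodType} (F : nat -> nat -> V) (i j : nat) : V :=
  \sum_(i <= l < j) \sum_(i <= k < l) F k l.

Lemma pairsum_short {V : nmodType} (F : nat -> nat -> V) i j :
  (j <= i.+1)%N -> pairsum F i j = 0.
Proof.
move=> ij; rewrite /pairsum big_nat big1// => l /andP[il lj].
by rewrite big_geq//; lia.
Qed.

Lemma pairsum_split {V : nmodType} (F : nat -> nat -> V) i m j :
  (i <= m <= j)%N ->
  pairsum F i j = pairsum F i m + pairsum F m j +
    \sum_(m <= l < j) \sum_(i <= k < m) F k l.
Proof.
move=> /andP[im mj]; rewrite /pairsum (big_cat_nat (n := m))//= -addrA.
congr (_ + _); rewrite -big_split/=; apply: eq_big_nat => l /andP[ml lj].
by rewrite (big_cat_nat (n := m))//= addrC.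
Qed.

Lemma ler_pairsum {R : numDomainType} (F G : nat -> nat -> R) i j :
  (forall k l, (i <= k)%N -> (k < l)%N -> (l < j)%N -> F k l <= G k l) ->
  pairsum F i j <= pairsum G i j.
Proof.
move=> FG; rewrite /pairsum big_nat [leRHS]big_nat.
apply: ler_sum => l /andP[il lj]; rewrite big_nat [leRHS]big_nat.
by apply: ler_sum => k /andP[ik kl]; apply: FG.
Qed.

Lemma eq_pairsum {V : nmodType} (F G : nat -> nat -> V) i j :
  (forall k l, (i <= k)%N -> (k < l)%N -> (l < j)%N -> F k l = G k l) ->
  pairsum F i j = pairsum G i j.
Proof.
move=> FG; rewrite /pairsum; apply: eq_big_nat => l /andP[il lj].
by apply: eq_big_nat => k /andP[ik kl]; apply: FG.
Qed.

Lemma pairsumD {V : nmodType} (F G : nat -> nat -> V) i j :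
  pairsum (fun k l => F k l + G k l) i j = pairsum F i j + pairsum G i j.
Proof.
rewrite /pairsum -big_split; apply: eq_bigr => l _.
by rewrite big_split.
Qed.

Lemma pairsumZ {R : pzRingType} (c : R) (F : nat -> nat -> R) i j :
  pairsum (fun k l => c * F k l) i j = c * pairsum F i j.
Proof.
rewrite /pairsum mulr_sumr; apply: eq_bigr => l _.
by rewrite mulr_sumr.
Qed.

Lemma sqr_sum_pairsum {R : comPzRingType} (f : nat -> R) i j :
  (\sum_(i <= k < j) f k) ^+ 2 =
  \sum_(i <= k < j) f k ^+ 2 + pairsum (fun k l => f k * f l) i j *+ 2.
Proof.
have [ji|ij] := leqP j i.
  by rewrite pairsum_short ?(leqW ji)// !big_geq// mul0rn addr0 expr0n.
rewrite -(subnKC (ltnW ij)); elim: (j - i)%N => [|m IH].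
  by rewrite addn0 pairsum_short// !big_geq// mul0rn addr0 expr0n.
have -> : pairsum (fun k l => f k * f l) i (i + m.+1) =
    pairsum (fun k l => f k * f l) i (i + m) +
    (\sum_(i <= k < i + m) f k) * f (i + m)%N.
  by rewrite /pairsum addnS big_nat_recr ?leq_addr//= mulr_suml.
rewrite addnS !big_nat_recr ?leq_addr//= sqrrD IH.
by ring.
Qed.

Lemma argmin_nat {R : realDomainType} (f : nat -> R) i j : (i < j)%N ->
  exists2 p, (i <= p < j)%N & forall r, (i <= r < j)%N -> f p <= f r.
Proof.
move=> ij; rewrite -(subnKC (ltnW ij)).
have : (0 < j - i)%N by lia.
elim: (j - i)%N => // -[_ _|m /(_ isT) [p ip fp] _].
  by exists i => [|r ri]; [lia|have -> : r = i by lia].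
have [fpm|/ltW fmp] := leP (f p) (f (i + m.+1)%N).
- exists p => [|r ir]; first by lia.
  have [->//|rm] := eqVneq r (i + m.+1)%N.
  by apply: fp; lia.
- exists (i + m.+1)%N => [|r ir]; first by lia.
  have [->//|rm] := eqVneq r (i + m.+1)%N.
  by apply: (le_trans fmp); apply: fp; lia.
Qed.

(** Here [ell n] is minus the logarithm of the n-th gap, so that the
assumption on [G] says that a pair interacts with the strength of the widest gap
that separates it, up to [C].  The block is cut at its widest gap [p]: each pair
across the cut has strength [ell p], and the two sides satisfy the bound with
[ell p] in place of [M].  The recursion needs the free lower bound [M] on the
[ell r] because the two sides contribute [ell p] times their own pair sums,
which combine with the cross pairs to [ell p] times the pair sum of the whole
block, and that sum is at most [- eta]. *)
Lemma cluster_bound {R : realDomainType} (q : nat -> R) (ell : nat -> R)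
    (G : nat -> nat -> R) (C eta : R) i j :
  0 <= eta ->
  (forall i' j', (i <= i')%N -> (i'.+1 < j')%N -> (j' <= j)%N ->
     pairsum (fun k l => q k * q l) i' j' <= - eta) ->
  (forall k p l, (i <= k <= p)%N -> (p < l < j)%N ->
     (forall r, (k <= r < l)%N -> ell p <= ell r) ->
     `|G k l - ell p| <= C) ->
  forall n M, (i <= n)%N -> (n.+1 < j)%N ->
  (forall r, (i <= r)%N -> (r.+1 < j)%N -> M <= ell r) ->
  pairsum (fun k l => q k * q l * G k l) i j <=
    M * pairsum (fun k l => q k * q l) i j - eta * (ell n - M)
    + C * pairsum (fun k l => `|q k * q l|) i j.
Proof.
move=> eta0; have [s] := ubnP (j - i)%N.
elim: s i j => // s IH i j sij hS hG n M i_n nj hM.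
have [p /andP[ip pj] pmin] := argmin_nat ell i j.-1 ltac:(lia).
have cross : \sum_(p.+1 <= l < j) \sum_(i <= k < p.+1) q k * q l * G k l <=
    ell p * (\sum_(p.+1 <= l < j) \sum_(i <= k < p.+1) q k * q l) +
    C * (\sum_(p.+1 <= l < j) \sum_(i <= k < p.+1) `|q k * q l|).
  rewrite !mulr_sumr -big_split/= big_nat [leRHS]big_nat.
  apply: ler_sum => l /andP[pl lj]; rewrite !mulr_sumr -big_split/=.
  rewrite big_nat [leRHS]big_nat; apply: ler_sum => k /andP[ik kp].
  rewrite -lerBlDl [ell p * _]mulrC -mulrBr (le_trans (ler_norm _))//.
  rewrite normrM mulrC ler_wpM2r//; apply: hG; [lia|lia|].
  by move=> r kr; apply: pmin; lia.
(* For a side without the gap [n], which may consist of a single wall. *)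
have weak i' j' : (i <= i')%N -> (j' <= j)%N -> (j' - i' < s)%N ->
    pairsum (fun k l => q k * q l * G k l) i' j' <=
    ell p * pairsum (fun k l => q k * q l) i' j' +
    C * pairsum (fun k l => `|q k * q l|) i' j'.
  move=> ii jj ss; have [ji|ij] := leqP j' i'.+1.
    by rewrite !pairsum_short// !mulr0 addr0.
  apply: le_trans (IH i' j' _ _ _ i' (ell p) _ _ _) _ => //.
  - by move=> *; apply: hS; lia.
  - by move=> *; apply: hG => //; lia.
  - by move=> *; apply: pmin; lia.
  - rewrite lerD2r gerDl oppr_le0 mulr_ge0// subr_ge0.
    by apply: pmin; lia.
(* For the side that contains the gap [n]. *)
have sharp i' j' : (i <= i')%N -> (j' <= j)%N -> (j' - i' < s)%N ->
    (i' <= n)%N -> (n.+1 < j')%N ->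
    pairsum (fun k l => q k * q l * G k l) i' j' <=
    ell p * pairsum (fun k l => q k * q l) i' j' - eta * (ell n - ell p) +
    C * pairsum (fun k l => `|q k * q l|) i' j'.
  move=> ii jj ss i'n nj'; apply: IH => //.
  - by move=> *; apply: hS; lia.
  - by move=> *; apply: hG => //; lia.
  - by move=> *; apply: pmin; lia.
have Sij : pairsum (fun k l => q k * q l) i j <= - eta by apply: hS; lia.
have Mp : M <= ell p by apply: hM; lia.
have hSM := ler_wpM2r (ltac:(by rewrite subr_ge0) : 0 <= ell p - M) Sij.
have ipj : (i <= p.+1 <= j)%N by lia.
move: hSM; rewrite !(pairsum_split _ i p.+1 j)//; move: cross.
set X := \sum_(_ <= _ < _) _; set Y := \sum_(_ <= _ < _) _.
set Z := \sum_(_ <= _ < _) _.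
have [npe|[np|pn]] : n = p \/ (n < p)%N \/ (p < n)%N by lia.
- have := weak i p.+1 ltac:(lia) ltac:(lia) ltac:(lia).
  have := weak p.+1 j ltac:(lia) ltac:(lia) ltac:(lia).
  by rewrite npe; lra.
- have := sharp i p.+1 ltac:(lia) ltac:(lia) ltac:(lia) ltac:(lia) ltac:(lia).
  have := weak p.+1 j ltac:(lia) ltac:(lia) ltac:(lia).
  by lra.
- have := weak i p.+1 ltac:(lia) ltac:(lia) ltac:(lia).
  have := sharp p.+1 j ltac:(lia) ltac:(lia) ltac:(lia) ltac:(lia) ltac:(lia).
  by lra.
Qed.

Lemma finite_uniform_lt0 {R : realDomainType} (f : nat -> nat -> R) N :
  (forall i j, (i.+1 < j)%N -> (j <= N)%N -> f i j < 0) ->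
  exists2 eta, 0 < eta &
    forall i j, (i.+1 < j)%N -> (j <= N)%N -> f i j <= - eta.
Proof.
move=> fN.
pose P (x : 'I_N.+1 * 'I_N.+1) := (x.1.+1 < x.2)%N.
exists (\big[Num.min/1]_(x | P x) - f x.1 x.2).
  apply: (big_ind (fun v => 0 < v)) => //.
    by move=> x y x0 y0; rewrite lt_min x0.
  by move=> [i j] /= ij; rewrite oppr_gt0 fN// -ltnS.
move=> i j ij jN; rewrite lerNr.
have iN : (i < N.+1)%N by lia.
have ijP : P (Ordinal iN, Ordinal (jN : (j < N.+1)%N)) by [].
exact: (bigmin_le_cond 1 (fun x : 'I_N.+1 * 'I_N.+1 => - f x.1 x.2) ijP).
Qed.

(** * Blocks of alternating charges *)

Definition charge {R : pzRingType} (c : R) (e k : nat) : R := (-1) ^+ (k + e) - c.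

Lemma sum_signs {R : pzRingType} (e i m : nat) :
  \sum_(i <= k < i + m) (-1) ^+ (k + e) = (-1) ^+ (i + e) *+ odd m :> R.
Proof.
elim: m => [|m IH]; first by rewrite addn0 big_geq.
rewrite addnS big_nat_recr ?leq_addr//= IH -addnA (addnCA i) (exprD _ m) /=.
rewrite -[(-1) ^+ m]signr_odd; case: (odd m) => /=.
  by rewrite expr1 mulN1r subrr.
by rewrite expr0 mul1r add0r.
Qed.

(** The square of the sum of the charges is their sum of squares plus
twice the pair sum, and the signs of a block add up to 0 or to the first one. *)
Lemma block_charge {R : comPzRingType} (c : R) e i m :
  pairsum (fun k l => charge c e k * charge c e l) i (i + m) *+ 2 =
  if odd m then (m%:R - 1) * (m%:R * c ^+ 2 - (-1) ^+ (i + e) * c *+ 2 - 1)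
  else m%:R * ((m%:R - 1) * c ^+ 2 - 1).
Proof.
have /(congr1 (fun x => x - \sum_(i <= k < i + m) charge c e k ^+ 2)) :=
  sqr_sum_pairsum (charge c e) i (i + m).
rewrite addrAC subrr add0r => <-.
have -> : \sum_(i <= k < i + m) charge c e k ^+ 2 =
    m%:R * (1 + c ^+ 2) - c *+ 2 * ((-1) ^+ (i + e) *+ odd m).
  rewrite -sum_signs mulr_sumr.
  have -> : m%:R * (1 + c ^+ 2) = \sum_(i <= k < i + m) (1 + c ^+ 2).
    by rewrite sumr_const_nat addKn mulr_natl.
  rewrite -sumrB; apply: eq_bigr => k _.
  by rewrite /charge sqrrB sqrr_sign mulrnAl addrAC [c * _]mulrC.
have -> : \sum_(i <= k < i + m) charge c e k =
    (-1) ^+ (i + e) *+ odd m - m%:R * c.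
  by rewrite /charge sumrB sum_signs sumr_const_nat addKn mulr_natl.
have := @sqrr_sign R (i + e); set s := (-1) ^+ (i + e) => s2.
case: (odd m); rewrite ?mulr1n ?mulr0n; last by ring.
by rewrite sqrrB s2; ring.
Qed.

(** The cosine of [theta]: for n > 2, (sqrt (m + 1) - 1) / m equals
1 / (sqrt (m + 1) + 1), with m = n for odd n and m = n - 1 for even n. *)
Definition threshold {R : realType} (n : nat) : R :=
  if (n <= 2)%N then 1
  else ((if odd n then Num.sqrt n.+1%:R else Num.sqrt n%:R) + 1)^-1.

Lemma threshold_gt0 {R : realType} n : 0 < threshold n :> R.
Proof.
rewrite /threshold; case: ifP => // _; rewrite invr_gt0.
by rewrite ltr_wpDl//; case: ifP.
Qed.

Lemma threshold_le1 {R : realType} n : threshold n <= 1 :> R.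
Proof.
rewrite /threshold; case: ifP => // _; rewrite invf_le1.
  by rewrite lerDr; case: ifP.
by rewrite ltr_wpDl//; case: ifP.
Qed.

Lemma thetaE {R : realType} n : theta R n = acos (threshold n).
Proof.
have key (r m : R) : 0 < m -> 0 <= r -> r ^+ 2 = m + 1 -> (r - 1) / m = (r + 1)^-1.
  move=> m0 r0 rm; have -> : m = (r - 1) * (r + 1).
    by rewrite -subr_sqr expr1n rm addrK.
  have r1 : 1 < r by rewrite -(@ltr_pXn2r _ 2)// ?nnegrE// expr1n rm ltrDr.
  by field; apply/andP; split; lra.
rewrite /theta /threshold; have [n2|n2] := leqP n 2; first by rewrite acos1.
have n0 : (0 < n)%N by lia.
case: (odd n); rewrite ?natr1; (congr acos; apply: key).
- by rewrite ltr0n.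
- by rewrite sqrtr_ge0.
- by rewrite sqr_sqrtr ?ler0n// natr1.
- by rewrite subr_gt0 ltr1n; lia.
- by rewrite sqrtr_ge0.
- by rewrite sqr_sqrtr ?ler0n// subrK.
Qed.

Lemma cos_theta {R : realType} n : cos (theta R n) = threshold n.
Proof.
have th := @threshold_gt0 R n; have th1 := @threshold_le1 R n.
by rewrite thetaE acosK// in_itv/=; apply/andP; split; lra.
Qed.

Lemma theta_itv {R : realType} n : 0 <= theta R n <= pi.
Proof.
have th := @threshold_gt0 R n; have th1 := @threshold_le1 R n.
by rewrite thetaE acos_ge0 ?acos_lepi//; apply/andP; split; lra.
Qed.

Lemma theta_lt_cos {R : realType} n (x : R) : 0 < x < pi ->
  (theta R n < x) = (cos x < threshold n).
Proof.
move=> /andP[x0 xpi]; have th := @theta_itv R n.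
by rewrite -cos_theta ltr_cos// in_itv/= ?th// !ltW.
Qed.

Lemma cos_theta_lt {R : realType} n (x : R) : 0 < x < pi ->
  (x < theta R n) = (threshold n < cos x).
Proof.
move=> /andP[x0 xpi]; have th := @theta_itv R n.
by rewrite -cos_theta ltr_cos// in_itv/= ?th// !ltW.
Qed.

Lemma cos_piB {R : realType} (x : R) : cos (pi - x) = - cos x.
Proof. by rewrite addrC cosDpi cosN. Qed.

(** With q^2 = Q at least m + 1 for odd m, and at least m for even m, both
cases reduce to ((q - 1) |c| + 1) ((q + 1) |c| - 1) < 0. *)
Lemma block_small {R : realType} (c q : R) e i m Q : 0 <= q -> q ^+ 2 = Q%:R ->
  (q + 1) * `|c| < 1 -> (2 <= m)%N -> (m + odd m <= Q)%N ->
  pairsum (fun k l => charge c e k * charge c e l) i (i + m) < 0.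
Proof.
move=> q0 qQ qc m2 mQ; rewrite -(pmulrn_llt0 _ (ltn0Sn 1)) block_charge.
have c0 : 0 <= `|c| by [].
have m2R : 2 <= m%:R :> R by rewrite ler_nat.
have c2 : c ^+ 2 = `|c| ^+ 2 by rewrite real_normK// num_real.
have q1 : 1 <= q.
  rewrite -(@ler_pXn2r _ 2)// ?nnegrE// expr1n qQ ler1n; lia.
have [mo|me] := boolP (odd m).
- have mq : m%:R + 1 <= q ^+ 2 :> R by rewrite qQ natr1 ler_nat; lia.
  have sc : - ((-1) ^+ (i + e) * c) <= `|c|.
    by rewrite (le_trans (ler_norm _))// normrN normrM normrX normrN1 expr1n mul1r.
  rewrite pmulr_rlt0; last lra.
  have : m%:R * c ^+ 2 <= (q ^+ 2 - 1) * `|c| ^+ 2.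
    by rewrite c2 ler_wpM2r// ?sqr_ge0//; lra.
  have : ((q - 1) * `|c| + 1) * ((q + 1) * `|c| - 1) < 0.
    rewrite pmulr_rlt0; first lra.
    by rewrite ltr_wpDl// mulr_ge0//; lra.
  by move: sc; set sc := _ ^+ _ * _; nra.
- have mq : m%:R <= q ^+ 2 :> R by rewrite qQ ler_nat; lia.
  rewrite pmulr_rlt0; last lra.
  have : (m%:R - 1) * c ^+ 2 <= (q ^+ 2 - 1) * `|c| ^+ 2.
    by rewrite c2 ler_wpM2r// ?sqr_ge0//; lra.
  have : ((q - 1) * `|c| + 1) * ((q + 1) * `|c| - 1) < 0.
    rewrite pmulr_rlt0; first lra.
    by rewrite ltr_wpDl// mulr_ge0//; lra.
  by nra.
Qed.

(** The range of d_1 * cos alpha when alpha is in [Theta].  Reversing all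
signs of [d] has the effect of replacing alpha by pi - alpha, which is why one
interval serves both alternating vectors. *)
Definition window {R : realType} (N : nat) : interval R :=
  `]- threshold N, threshold (if odd N then (N - 2)%N else N)[.

Lemma threshold_even {R : realType} n (x : R) : (2 < n)%N -> ~~ odd n ->
  (x < threshold n) = ((Num.sqrt n%:R + 1) * x < 1).
Proof.
move=> n2 no; rewrite /threshold leqNgt n2/= (negbTE no) -[_^-1]mul1r.
by rewrite ltr_pdivlMr ?ltr_wpDl ?sqrtr_ge0// mulrC.
Qed.

Lemma threshold_odd {R : realType} n (x : R) : (2 < n)%N -> odd n ->
  (x < threshold n) = ((Num.sqrt n.+1%:R + 1) * x < 1).
Proof.
move=> n2 no; rewrite /threshold leqNgt n2/= no -[_^-1]mul1r.
by rewrite ltr_pdivlMr ?ltr_wpDl ?sqrtr_ge0// mulrC.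
Qed.

Lemma block_pair {R : realType} (c : R) e i : `|c| < 1 ->
  pairsum (fun k l => charge c e k * charge c e l) i (i + 2) < 0.
Proof.
move=> c1; rewrite -(pmulrn_llt0 _ (ltn0Sn 1)) block_charge/=.
by rewrite -[c ^+ 2]real_normK ?num_real//; have := normr_ge0 c; nra.
Qed.

(** The full configuration has only one first sign, hence only a one-sided
constraint at 1 / (r + 1); the other root 1 / (r - 1) is farther out. *)
Lemma block_whole {R : realType} (c r : R) e N : (2 < N)%N -> odd N ->
  1 < r -> r ^+ 2 = N.+1%:R -> -1 < (r + 1) * ((-1) ^+ e * c) ->
  (r - 1) * ((-1) ^+ e * c) < 1 ->
  pairsum (fun k l => charge c e k * charge c e l) 0 N < 0.
Proof.
move=> N2 No r1 rN b1 b2; rewrite -[X in pairsum _ _ X]add0n.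
rewrite -(pmulrn_llt0 _ (ltn0Sn 1)) block_charge No add0n.
have -> : c ^+ 2 = ((-1) ^+ e * c) ^+ 2 by rewrite exprMn sqrr_sign mul1r.
move: b1 b2; set b := _ * c => b1 b2.
have NE : N%:R = r ^+ 2 - 1 :> R by rewrite rN -natr1 addrK.
rewrite pmulr_rlt0; last by rewrite subr_gt0 ltr1n; lia.
have : ((r + 1) * b + 1) * ((r - 1) * b - 1) < 0.
  by rewrite pmulr_rlt0; lra.
by rewrite NE; nra.
Qed.

Lemma add_odd_leq m Q : ~~ odd Q -> (m <= Q)%N -> (m + odd m <= Q)%N.
Proof.
move=> Qe mQ; case: (boolP (odd m)) => mo; last by rewrite addn0.
by rewrite addn1 ltn_neqAle mQ andbT; apply: contraNneq Qe => <-.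
Qed.

Lemma threshold_pred {R : realType} N : (2 < N)%N -> ~~ odd N ->
  threshold N = threshold N.-1 :> R.
Proof.
case: N => // N N2; rewrite /= negbK => No; rewrite /threshold.
have {}N2 : (2 < N)%N by rewrite ltn_neqAle -ltnS N2 andbT; apply: contraTneq No => <-.
by rewrite !(leqNgt _ 2) N2 (leqW N2) /= No.
Qed.

(** Blocks of length 2 satisfy the inequality for every angle.  All
other blocks but the whole one of odd N fall under [block_small], with Q = N for
even N and Q = N - 1 for odd N.  The case N = 3 is apart because [threshold 1]
is 1 and not 1 / (sqrt 2 + 1). *)
Lemma window_stable {R : realType} (c : R) e N : (2 <= N)%N -> `|c| < 1 ->
  (-1) ^+ e * c \in window N ->
  forall i m, (2 <= m)%N -> (i + m <= N)%N ->
  pairsum (fun k l => charge c e k * charge c e l) i (i + m) < 0.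
Proof.
move=> N2 c1; rewrite in_itv/= => /andP[bl bu] i m m2 imN.
have [->|m2'] := eqVneq m 2; first exact: block_pair.
have m3 : (2 < m)%N by lia.
have cb : `|c| = `|(-1) ^+ e * c| by rewrite normrM normrX normrN1 expr1n mul1r.
have [No|Ne] := boolP (odd N); rewrite ?No ?(negbTE Ne) in bu; last first.
  move: bl; rewrite -ltrNl; have N4 : (2 < N)%N by clear -m3 imN; lia.
  move: bu; rewrite !threshold_even// => bu bl.
  apply: (@block_small _ _ (Num.sqrt N%:R) _ _ _ N) => //.
  - by rewrite sqr_sqrtr.
  - rewrite cb; case: (ger0P ((-1) ^+ e * c)) => _; lra.
  - apply: add_odd_leq => //; exact: leq_trans (leq_addl _ _) imN.
have N3 : (2 < N)%N by clear -m3 imN; lia.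
move: bl; rewrite -ltrNl threshold_odd// => bl.
set r : R := Num.sqrt N.+1%:R in bl.
have rN : r ^+ 2 = N.+1%:R by rewrite sqr_sqrtr.
have r2 : 2 <= r.
  by rewrite -(@ler_pXn2r _ 2)// ?nnegrE ?sqrtr_ge0// rN -natrX ler_nat; exact: N3.
(* For N = 3, r = 2 and the root 1 / (r - 1) is 1. *)
have [N3'|N3'] := eqVneq N 3.
  have -> : i = 0 by clear -m3 imN N3'; lia.
  have -> : m = N by clear -m3 imN N3'; lia.
  apply: (@block_whole _ _ r) => //; rewrite ?add0n//; try lra.
  have : (-1) ^+ e * c <= `|c| by rewrite cb ler_norm.
  have rr : r = 2.
    have : (r - 2) * (r + 2) = 0.
      by rewrite -subr_sqr rN N3' -natrX subrr.
    by move/eqP; rewrite mulf_eq0 => /orP[] /eqP; lra.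
  by rewrite rr; lra.
have {N3'}N5 : (5 <= N)%N.
  by case: N No N3 N3' {N2 imN bl bu rN r r2} => [|[|[|[|[|]]]]].
move: bu; rewrite threshold_odd ?oddB ?No ?(ltnW N3)//; last first.
  by clear -N5; lia.
have -> : ((N - 2).+1 = N.-1)%N by clear -N5; lia.
set q : R := Num.sqrt N.-1%:R => bu.
have qN : q ^+ 2 = N.-1%:R by rewrite sqr_sqrtr.
have q2 : 2 <= q.
  by rewrite -(@ler_pXn2r _ 2)// ?nnegrE ?sqrtr_ge0// qN -natrX ler_nat; clear -N5; lia.
have qr2 : r ^+ 2 = q ^+ 2 + 2.
  by rewrite qN rN -natrD; congr (_%:R); clear -N5; lia.
(* These compare 1 / (r + 1) and 1 / (r - 1) with 1 / (q + 1). *)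
have qr : q <= r by nra.
have rq : r <= q + 2 by nra.
have b1 : (q + 1) * `|c| < 1.
  rewrite cb; case: (ger0P ((-1) ^+ e * c)) => [//|b0].
  by move: (_ * c) bl b0 => b; nra.
have [mN|mN] := eqVneq m N.
- have -> : i = 0 by clear -mN imN; lia.
  rewrite mN; apply: (@block_whole _ _ r) => //; try lra.
  have [b0|b0] := ltP ((-1) ^+ e * c) 0; first by nra.
  by move: (_ * c) bu b0 => b; nra.
- apply: (@block_small _ _ q _ _ _ N.-1) => //; try lra.
  apply: add_odd_leq; first by rewrite -oddS prednK// ltnW// ltnW.
  by clear -mN imN N3; lia.
Qed.

(** A block of odd length m with first sign s has a positive pair sum as
soon as - s c exceeds [threshold m].  Below the window this happens for a block
that starts at 0, above it for one that starts at 1 and has the opposite first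
sign. *)
Lemma window_unstable {R : realType} (c : R) e N : (3 <= N)%N -> `|c| < 1 ->
  (-1) ^+ e * c < - threshold N \/
  threshold (if odd N then (N - 2)%N else N) < (-1) ^+ e * c ->
  exists i j, [/\ (i < j)%N, (j <= N)%N &
    0 < pairsum (fun k l => charge c e k * charge c e l) i j].
Proof.
move=> N3 c1.
have pos i m : odd m -> (2 < m)%N -> (i + m <= N)%N ->
    threshold m < - ((-1) ^+ (i + e) * c) ->
    exists i j, [/\ (i < j)%N, (j <= N)%N &
      0 < pairsum (fun k l => charge c e k * charge c e l) i j].
  move=> mo m2 imN; set b := (-1) ^+ _ * c => b1.
  exists i, (i + m)%N; split; [lia|lia|].
  rewrite -(pmulrn_lgt0 _ (ltn0Sn 1)) block_charge mo.
  have -> : c ^+ 2 = b ^+ 2 by rewrite exprMn sqrr_sign mul1r.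
  rewrite -/b.
  have mE : m%:R = Num.sqrt m.+1%:R ^+ 2 - 1 :> R.
    by rewrite sqr_sqrtr// -natr1 addrK.
  have r0 : 0 <= Num.sqrt m.+1%:R :> R by [].
  have m1 : 1 < m%:R :> R by rewrite ltr1n; lia.
  move: b1; rewrite /threshold leqNgt m2/= mo -[_^-1]mul1r.
  rewrite ltr_pdivrMr ?ltr_wpDl//.
  rewrite pmulr_rgt0; last by rewrite subr_gt0.
  move: (Num.sqrt _) r0 mE => r r0 mE b1.
  have r1 : 1 < r by nra.
  have b0 : b < 0 by nra.
  have : 0 < ((r + 1) * - b - 1) * ((r - 1) * - b + 1).
    by rewrite mulr_gt0//; nra.
  by rewrite mE; nra.
have [No|Ne] := boolP (odd N).
- case=> [b1|b1].
  + by apply: (pos 0 N) => //; rewrite add0n ltrNr.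
  + have [N3'|N3'] := eqVneq N 3.
      have : (-1) ^+ e * c <= `|c|.
        by rewrite (le_trans (ler_norm _))// normrM normrX normrN1 expr1n mul1r.
      by move: b1; rewrite N3' /threshold/=; lra.
    have N5 : (5 <= N)%N by case: N No N3 N3' {c1 pos b1} => [|[|[|[|[|]]]]].
    apply: (pos 1 (N - 2)%N).
    - by rewrite oddB ?No// ltnW.
    - by clear -N5; lia.
    - by clear -N5; lia.
    by rewrite add1n exprS mulN1r mulNr opprK.
- rewrite threshold_pred//.
  have N4 : (2 < N.-1)%N by case: N N3 Ne {c1 pos} => [|[|[|[|]]]].
  have No : odd N.-1 by rewrite -[odd _]negbK -oddS prednK// ltnW// ltnW.
  case=> b1.
  + by apply: (pos 0 N.-1) => //; [exact: leq_pred|rewrite add0n ltrNr].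
  + apply: (pos 1 N.-1) => //; first by rewrite add1n prednK// ltnW// ltnW.
    by rewrite add1n exprS mulN1r mulNr opprK.
Qed.

(** * The set of angles *)

Lemma not_closure_itv {R : realType} (x y a : R) : x < y ->
  ~ closure `]x, y[%classic a -> a < x \/ y < a.
Proof.
move=> xy na; have [ax|xa] := ltP a x; first by left.
have [ya|ay] := ltP y a; first by right.
exfalso; apply: na => B Ba.
have [ay'|ya] := ltP a y.
- have : \forall t \near a^'+, (`]x, y[%classic `&` B) t.
    near=> t; split => /=; last by near: t; exact: cvg_within.
    rewrite in_itv/=; apply/andP; split; last by near: t; exact: nbhs_right_lt.
    by apply: (le_lt_trans xa); near: t; exact: nbhs_right_gt.
  by move=> /filter_ex.
- have ax : x < a by apply: lt_le_trans ya.
  have : \forall t \near a^'-, (`]x, y[%classic `&` B) t.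
    near=> t; split => /=; last by near: t; exact: cvg_within.
    rewrite in_itv/=; apply/andP; split; first by near: t; exact: nbhs_left_gt.
    by apply: (lt_le_trans _ ay); near: t; exact: nbhs_left_lt.
  by move=> /filter_ex.
Unshelve. all: by end_near. Qed.

Lemma alternating_signs {R : realType} N (d : 'rV[R]_N) :
  d = dplus R N \/ d = dminus R N ->
  exists e : bool, forall i, d 0 i = (-1) ^+ (i + e).
Proof.
move=> [->|->]; [exists false|exists true] => i; rewrite mxE.
- by rewrite addn0.
- by rewrite addn1.
Qed.

Lemma window_ThetaE {R : realType} N (e : bool) alpha : 0 < alpha < pi ->
  Theta N ((-1) ^+ e : R) alpha = ((-1) ^+ e * cos alpha \in window N) :> Prop.
Proof.
move=> ha; rewrite /Theta /window.
have lo n : (theta R n < alpha) = (cos alpha < threshold n).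
  exact: theta_lt_cos.
have hi n : (alpha < pi - theta R n) = (- threshold n < cos alpha).
  have ha' : 0 < pi - alpha < pi by move/andP: ha => [? ?]; lra.
  rewrite ltrBrDl -ltrBrDr theta_lt_cos// cos_piB.
  by rewrite ltrNl.
have e1 : ((-1) ^+ e == 1 :> R) = ~~ e.
  by case: e; rewrite ?expr1 ?expr0 ?eqxx// lt_eqF//; lra.
rewrite in_itv/=; case: (boolP (odd N)) => [No|Ne]; rewrite /= ?e1.
- case: e {e1} => /=; rewrite in_itv/= lo hi ?expr1 ?expr0 ?mulN1r ?mul1r.
  + by rewrite ltrN2 [- cos alpha < _]ltrNl.
  + by rewrite andbC.
- rewrite in_itv/= lo hi; case: e {e1}; rewrite ?expr1 ?expr0 ?mulN1r ?mul1r.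
  + by rewrite ltrN2 [- cos alpha < _]ltrNl.
  + by rewrite andbC.
Qed.

(** The interval is nonempty since all [theta] are below pi / 2, so its
closure contains its two ends. *)
Lemma not_closure_Theta {R : realType} N (e : bool) alpha : 0 < alpha < pi ->
  ~ closure (Theta N ((-1) ^+ e : R)) alpha ->
  (-1) ^+ e * cos alpha < - threshold N \/
  threshold (if odd N then (N - 2)%N else N) < (-1) ^+ e * cos alpha.
Proof.
move=> ha; rewrite /Theta.
have lo n : (alpha < theta R n) = (threshold n < cos alpha).
  exact: cos_theta_lt.
have hi n : (pi - theta R n < alpha) = (cos alpha < - threshold n).
  have ha' : 0 < pi - alpha < pi by move/andP: ha => [? ?]; lra.
  rewrite ltrBlDr addrC -ltrBlDr cos_theta_lt// cos_piB.
  by rewrite ltrNr.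
have ne m n : theta R m < pi - theta R n.
  rewrite ltrBrDr; apply: (@lt_le_trans _ _ (pi / 2 + pi / 2)); last by lra.
  have half k : theta R k < pi / 2.
    have pi0 := pi_gt0 R; rewrite theta_lt_cos; last by lra.
    by rewrite cos_pihalf threshold_gt0.
  by rewrite ltrD.
have e1 : ((-1) ^+ e == 1 :> R) = ~~ e.
  by case: e; rewrite ?expr1 ?expr0 ?eqxx// lt_eqF//; lra.
case: (boolP (odd N)) => [No|Ne]; rewrite /= ?e1.
- case: e {e1} => /= /not_closure_itv-/(_ (ne _ _)); rewrite lo hi ?expr1 ?expr0 ?mulN1r ?mul1r.
  + by rewrite ltrN2 ltrNr.
  + by case; [right|left].
- move=> /not_closure_itv-/(_ (ne _ _)); rewrite lo hi.
  case: e {e1}; rewrite ?expr1 ?expr0 ?mulN1r ?mul1r.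
  + by rewrite ltrN2 ltrNr.
  + by case; [right|left].
Qed.

(** * The pseudo-hyperbolic distance and the interaction *)

Definition interaction {R : realType} (b c : R) : R :=
  ln ((1 + Num.sqrt (1 - rho b c ^+ 2)) / rho b c).

Lemma rhoC {R : realType} (b c : R) : rho b c = rho c b.
Proof. by rewrite /rho distrC [b * c]mulrC. Qed.

Lemma interactionC {R : realType} (b c : R) : interaction b c = interaction c b.
Proof. by rewrite /interaction rhoC. Qed.

Lemma rho_den_gt0 {R : realType} (b c : R) : -1 < b < 1 -> -1 < c < 1 ->
  0 < 1 - b * c.
Proof. by move=> /andP[b1 b2] /andP[c1 c2]; nra. Qed.

Lemma rhoE {R : realType} (b c : R) : b < c -> rho b c = (c - b) / (1 - b * c).
Proof. by move=> bc; rewrite /rho distrC gtr0_norm ?subr_gt0. Qed.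

Lemma rho_itv {R : realType} (b c : R) : -1 < b < 1 -> -1 < c < 1 -> b < c ->
  0 < rho b c < 1.
Proof.
move=> hb hc bc; have d0 := rho_den_gt0 _ _ hb hc; rewrite rhoE//.
apply/andP; split; first by rewrite divr_gt0// subr_gt0.
rewrite ltr_pdivrMr// mul1r.
by move: hb hc => /andP[b1 b2] /andP[c1 c2]; nra.
Qed.

Lemma rho_le {R : realType} (x y z t : R) : -1 < x -> x <= y -> y < z ->
  z <= t -> t < 1 -> rho y z <= rho x t.
Proof.
move=> x1 xy yz zt t1.
have d (b c : R) : x <= b -> c <= t -> b < c -> 0 < 1 - b * c.
  by move=> *; apply: rho_den_gt0; lra.
apply: (@le_trans _ _ (rho y t)).
- have : 0 <= (t - z) * ((1 - y) * (1 + y)) by rewrite !mulr_ge0//; lra.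
  rewrite !rhoE; try lra; move=> h.
  rewrite ler_pdivrMr ?d//; try lra.
  by rewrite mulrAC ler_pdivlMr ?d//; lra.
- have : 0 <= (y - x) * ((1 - t) * (1 + t)) by rewrite !mulr_ge0//; lra.
  rewrite !rhoE; try lra; move=> h.
  rewrite ler_pdivrMr ?d//; try lra.
  by rewrite mulrAC ler_pdivlMr ?d//; lra.
Qed.

(** The deficit is the product of the three distances, by the addition
formula tanh (u + v) (1 + tanh u tanh v) = tanh u + tanh v. *)
Lemma rho_triangle {R : realType} (x y z : R) : -1 < x -> x < y -> y < z ->
  z < 1 -> rho x z <= rho x y + rho y z.
Proof.
move=> x1 xy yz z1.
have xi : -1 < x < 1 by lra.
have yi : -1 < y < 1 by lra.
have zi : -1 < z < 1 by lra.
have xz := lt_trans xy yz.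
have a1 := rho_den_gt0 _ _ xi yi; have a2 := rho_den_gt0 _ _ yi zi.
have a3 := rho_den_gt0 _ _ xi zi.
have E : rho x y + rho y z - rho x z = rho x y * rho y z * rho x z.
  by rewrite !rhoE//; field; rewrite !gt_eqF.
have /andP[u0 _] := rho_itv _ _ xi yi xy.
have /andP[v0 _] := rho_itv _ _ yi zi yz.
have /andP[w0 _] := rho_itv _ _ xi zi xz.
by rewrite -subr_ge0 E; apply/ltW/(mulr_gt0 (mulr_gt0 u0 v0) w0).
Qed.

Lemma interaction_bounds {R : realType} (b c : R) : 0 < rho b c <= 1 ->
  - ln (rho b c) <= interaction b c <= - ln (rho b c) + ln 2.
Proof.
rewrite /interaction; move: (rho b c) => r /andP[r0 r1].
have s0 : 0 <= Num.sqrt (1 - r ^+ 2) by [].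
have s1 : Num.sqrt (1 - r ^+ 2) <= 1.
  by rewrite -[leRHS]sqrtr1 ler_wsqrtr// gerBl sqr_ge0.
have s2 : 0 < 1 + Num.sqrt (1 - r ^+ 2) by lra.
rewrite lnM ?posrE ?invr_gt0// lnV ?posrE//.
have ln0 : 0 <= ln (1 + Num.sqrt (1 - r ^+ 2)) by apply: ln_ge0; lra.
have : ln (1 + Num.sqrt (1 - r ^+ 2)) <= ln 2 by rewrite ler_ln ?posrE//; lra.
by lra.
Qed.

Definition increasing_in {R : realType} (N : nat) (x : nat -> R) : Prop :=
  (forall k, (k < N)%N -> -1 < x k < 1) /\
  (forall k l, (k < l)%N -> (l < N)%N -> x k < x l).

Lemma increasing_in_le {R : realType} N (x : nat -> R) k l :
  increasing_in N x -> (k <= l)%N -> (l < N)%N -> x k <= x l.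
Proof.
move=> [_ xs] kl lN; have [->//|kl'] := eqVneq k l.
by apply/ltW/xs => //; lia.
Qed.

Lemma rho_le_gap {R : realType} N (x : nat -> R) (m : R) k l :
  increasing_in N x -> (k < l)%N -> (l < N)%N ->
  (forall r, (k <= r < l)%N -> rho (x r) (x r.+1) <= m) ->
  rho (x k) (x l) <= (l - k)%:R * m.
Proof.
move=> xN kl; rewrite -(subnKC kl).
elim: (l - k.+1)%N => [|n IH] lN hm.
  by rewrite addn0 subSnn mul1r hm//; lia.
have -> : (k.+1 + n.+1 - k = (k.+1 + n - k).+1)%N by lia.
rewrite -natr1 mulrDl mul1r addnS.
have [xb xs] := xN.
have kx := xs k (k.+1 + n)%N ltac:(lia) ltac:(lia).
have xk := xs (k.+1 + n)%N (k.+1 + n).+1 ltac:(lia) ltac:(lia).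
have /andP[xk1 _] := xb k ltac:(lia).
have /andP[_ xl1] := xb (k.+1 + n).+1 ltac:(lia).
apply: (le_trans (rho_triangle _ _ _ xk1 kx xk xl1)).
apply: lerD; last by apply: hm; lia.
by apply: IH => [|r hr]; [lia|apply: hm; lia].
Qed.

(** The distance of two walls lies between the widest gap that separates
them and N times that gap, which costs ln N; the ln 2 comes from
[interaction_bounds]. *)
Lemma interaction_gap {R : realType} N (x : nat -> R) k p l :
  increasing_in N x -> (k <= p)%N -> (p < l)%N -> (l < N)%N ->
  (forall r, (k <= r < l)%N ->
     - ln (rho (x p) (x p.+1)) <= - ln (rho (x r) (x r.+1))) ->
  `|interaction (x k) (x l) - - ln (rho (x p) (x p.+1))| <= ln N%:R + ln 2.
Proof.
move=> xN kp pl lN hp; have [xb xs] := xN.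
have rho01 r s : (r < s)%N -> (s < N)%N -> 0 < rho (x r) (x s) < 1.
  by move=> rs sN; apply: rho_itv; [apply: xb; lia|apply: xb|apply: xs].
have /andP[rp0 rp1] := rho01 p p.+1 ltac:(lia) ltac:(lia).
have /andP[r0 r1] := rho01 k l ltac:(lia) lN.
have N0 : 1 <= N%:R :> R by rewrite ler1n; lia.
have hp' r : (k <= r < l)%N -> rho (x r) (x r.+1) <= rho (x p) (x p.+1).
  move=> kr; have /andP[q0 q1] := rho01 r r.+1 ltac:(lia) ltac:(lia).
  by rewrite -ler_ln ?posrE// -lerN2; apply: hp.
have up : rho (x k) (x l) <= N%:R * rho (x p) (x p.+1).
  apply: le_trans (rho_le_gap N x _ k l xN _ lN hp') _; first lia.
  by rewrite ler_wpM2r ?ler_nat ?ltW//; lia.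
have lo : rho (x p) (x p.+1) <= rho (x k) (x l).
  have /andP[xk1 _] := xb k ltac:(lia); have /andP[_ xl1] := xb l lN.
  apply: rho_le => //.
  - by apply: (increasing_in_le N) => //; lia.
  - by apply: xs; lia.
  - by apply: (increasing_in_le N) => //; lia.
have lnup : ln (rho (x k) (x l)) <= ln N%:R + ln (rho (x p) (x p.+1)).
  rewrite -lnM ?posrE//; last lra.
  by rewrite ler_ln// posrE; apply: mulr_gt0 => //; lra.
have lnlo : ln (rho (x p) (x p.+1)) <= ln (rho (x k) (x l)).
  by rewrite ler_ln ?posrE.
have := interaction_bounds (x k) (x l) ltac:(by rewrite r0 ltW).
have l2 : 0 <= ln 2 :> R by rewrite ln_ge0//; lra.
have lN0 : 0 <= ln N%:R :> R by rewrite ln_ge0.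
by move=> /andP[g1 g2]; rewrite ler_norml; lra.
Qed.

(** * Coercivity of the energy *)

(** [W] for configurations indexed by natural numbers, so that blocks can be
cut without casts between ordinals; every pair is counted once. *)
Definition energy {R : realType} (N : nat) (c : R) (e : nat) (x : nat -> R) : R :=
  - (pi / 2) * (\sum_(0 <= k < N) charge c e k ^+ 2 * ln (2 - 2 * x k ^+ 2))
  - pi * pairsum (fun k l => charge c e k * charge c e l *
                             interaction (x k) (x l)) 0 N.

Lemma sum_offdiag {V : nmodType} (F : nat -> nat -> V) N :
  (forall k l, F k l = F l k) ->
  \sum_(n < N) \sum_(k < N | k != n) F k n = pairsum F 0 N *+ 2.
Proof.
move=> FC.
transitivity (\sum_(0 <= n < N) \sum_(0 <= k < N | k != n) F k n).
  by rewrite big_mkord; apply: eq_bigr => n _; rewrite big_mkord.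
elim: N => [|N IH]; first by rewrite pairsum_short// !big_nil mul0rn.
have -> : pairsum F 0 N.+1 = pairsum F 0 N + \sum_(0 <= k < N) F k N.
  by rewrite /pairsum big_nat_recr.
rewrite mulrnDl -IH big_nat_recr//=.
have -> : \sum_(0 <= k < N.+1 | k != N) F k N = \sum_(0 <= k < N) F k N.
  rewrite big_mkcond big_nat_recr//= eqxx addr0.
  by apply: eq_big_nat => k kN; rewrite ltn_eqF//; lia.
rewrite mulr2n addrA; congr (_ + _).
rewrite -big_split; apply: eq_big_nat => n nN /=.
rewrite [LHS]big_mkcond big_nat_recr//= -big_mkcond FC.
by rewrite gtn_eqF//; lia.
Qed.

Lemma W_energy {R : realType} N alpha e (a d : 'rV[R]_N) (x : nat -> R) :
  (forall i, a 0 i = x i) -> (forall i, d 0 i = (-1) ^+ (i + e)) ->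
  W alpha a d = energy N (cos alpha) e x.
Proof.
move=> ax ds.
have gE (n : 'I_N) : gamma alpha d n = charge (cos alpha) e n.
  by rewrite /gamma /charge ds.
rewrite /W /energy; congr (_ - _).
  by rewrite big_mkord; congr (_ * _); apply: eq_bigr => n _; rewrite gE ax.
under eq_bigr do under eq_bigr do rewrite !gE !ax -/(interaction _ _).
rewrite (sum_offdiag (fun k l => charge (cos alpha) e k *
  charge (cos alpha) e l * interaction (x k) (x l))); last first.
  by move=> k l; rewrite interactionC [_ * charge _ _ l]mulrC.
by rewrite -[pairsum _ _ _ *+ 2]mulr_natl mulrA divfK.
Qed.

(** The self-energies are bounded below, and by [cluster_bound] so are the
interactions.  A bound on the total energy therefore bounds each self-energy,
which keeps the walls away from -1 and 1, and the logarithm of each gap.  Gaps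
measured by [rho] turn into Euclidean ones because 1 - x_k * x_l is bounded below
by the distance of a wall to the ends of the interval. *)
Lemma sublevel_margin {R : realType} N (c : R) e K : (2 <= N)%N -> `|c| < 1 ->
  (forall i j, (i.+1 < j)%N -> (j <= N)%N ->
     pairsum (fun k l => charge c e k * charge c e l) i j < 0) ->
  exists2 delta, 0 < delta & forall x, increasing_in N x ->
    energy N c e x <= K ->
    (forall k, (k < N)%N -> delta <= 1 - `|x k|) /\
    (forall k l, (k < l)%N -> (l < N)%N -> delta <= x l - x k).
Proof.
move=> N2 c1 /finite_uniform_lt0[eta eta0 hS].
have pi0 := pi_gt0 R.
pose A := pairsum (fun k l => `|charge c e k * charge c e l|) 0 N.
pose C : R := ln N%:R + ln 2.
pose G := \sum_(0 <= k < N) charge c e k ^+ 2.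
pose T := (K + pi / 2 * (ln 2 * G) + pi * (C * A)) / pi.
have g20 : 0 < (1 - `|c|) ^+ 2 by rewrite exprn_gt0// subr_gt0.
pose d1 := expR (- (2 * T / (1 - `|c|) ^+ 2)) / 2.
pose d2 := expR (- (T / eta)).
have d10 : 0 < d1 by rewrite divr_gt0// expR_gt0.
have d20 : 0 < d2 by rewrite expR_gt0.
exists (Num.min d1 (d2 * d1)); first by rewrite lt_min d10 mulr_gt0.
move=> x xN xK; have [xb xs] := xN.
pose ell n := - ln (rho (x n) (x n.+1)).
have rho01 n : (n.+1 < N)%N -> 0 < rho (x n) (x n.+1) < 1.
  by move=> nN; apply: rho_itv; [apply/xb/ltnW|apply: xb|apply: xs].
have ell0 n : (n.+1 < N)%N -> 0 <= ell n.
  by move=> /rho01/andP[r0 r1]; rewrite oppr_ge0 ln_le0// ltW.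
have pairs n : (n.+1 < N)%N ->
    pairsum (fun k l => charge c e k * charge c e l * interaction (x k) (x l))
      0 N <= C * A - eta * ell n.
  move=> nN.
  have := cluster_bound (charge c e) ell
    (fun k l => interaction (x k) (x l)) C eta 0 N (ltW eta0) _ _ n 0 _ _ _.
  rewrite mul0r add0r subr0 addrC; apply => //.
  - by move=> *; apply: hS.
  - by move=> k p l /andP[_ kp] /andP[pl lN] hr; apply: interaction_gap.
  - by move=> *; apply: ell0.
(* The self-energy of wall [k], shifted to be nonnegative. *)
pose B k := charge c e k ^+ 2 * (ln 2 - ln (2 - 2 * x k ^+ 2)).
have x2 k : (k < N)%N -> 0 < 1 - x k ^+ 2.
  by move=> /xb/andP[x1 x2]; nra.
have B0 k : (k < N)%N -> 0 <= B k.
  move=> kN; have xk := x2 k kN; rewrite mulr_ge0 ?sqr_ge0// subr_ge0.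
  by rewrite ler_ln ?posrE//; have := sqr_ge0 (x k); lra.
have EB : \sum_(0 <= k < N) charge c e k ^+ 2 * ln (2 - 2 * x k ^+ 2) =
    ln 2 * G - \sum_(0 <= k < N) B k.
  by rewrite mulr_sumr -sumrB; apply: eq_bigr => k _; rewrite /B; ring.
have total n : (n.+1 < N)%N -> (\sum_(0 <= k < N) B k) / 2 + eta * ell n <= T.
  move=> nN; move: xK; rewrite /energy EB => xK.
  rewrite /T ler_pdivlMr//.
  have := ler_wpM2l (ltW pi0) (pairs n nN).
  by move: xK; rewrite /A; lra.
have SB0 : 0 <= \sum_(0 <= k < N) B k.
  by rewrite big_nat sumr_ge0// => k /andP[_ kN]; exact: B0.
have edge k : (k < N)%N -> d1 <= 1 - `|x k|.
  move=> kN.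
  have Bk : B k <= \sum_(0 <= k < N) B k.
    rewrite big_mkord (bigD1 (Ordinal kN))//= lerDl sumr_ge0// => i _.
    exact: B0.
  have BT : B k <= 2 * T.
    have := total 0 N2; have := mulr_ge0 (ltW eta0) (ell0 0 N2).
    by lra.
  have xk := x2 k kN; have xk1 := xb k kN.
  (* The charges are bounded away from 0, because |c| < 1. *)
  have gk : (1 - `|c|) ^+ 2 <= charge c e k ^+ 2.
    rewrite -[leRHS]real_normK ?num_real// ler_pXn2r// ?nnegrE//; last first.
      by rewrite subr_ge0 ltW.
    have := lerB_dist ((-1) ^+ (k + e)) c.
    by rewrite normrX normrN1 expr1n.
  have : ln 2 - ln (2 - 2 * x k ^+ 2) <= 2 * T / (1 - `|c|) ^+ 2.
    rewrite ler_pdivlMr// mulrC (le_trans _ BT)// ler_wpM2r//.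
    by have := sqr_ge0 (x k); rewrite subr_ge0 ler_ln ?posrE//; lra.
  have l2 : 2 * expR (- (2 * T / (1 - `|c|) ^+ 2)) = expR (ln 2 - 2 * T / (1 - `|c|) ^+ 2).
    by rewrite expRD lnK// posrE.
  rewrite lerBlDl -lerBlDr => hl.
  have : 2 * (d1 * 2) <= 2 - 2 * x k ^+ 2.
    rewrite /d1 divfK// l2 -[leRHS]lnK ?posrE; last by lra.
    by rewrite ler_expR.
  rewrite -[x k ^+ 2]real_normK ?num_real//.
  have : `|x k| < 1 by rewrite ltr_norml.
  by have := normr_ge0 (x k); nra.
split=> [k kN|k l kl lN]; first by rewrite ge_min edge.
apply: (@le_trans _ _ (d2 * d1)); first by rewrite ge_min lexx orbT.
have kN : (k.+1 < N)%N := leq_ltn_trans kl lN.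
have kN' : (k < N)%N := ltn_trans kl lN.
apply: (@le_trans _ _ (x k.+1 - x k)); last first.
  by rewrite lerB// (increasing_in_le N).
have xk := xb k kN'; have xk1 := xb k.+1 kN.
have den : d1 <= 1 - x k * x k.+1.
  apply: (le_trans (edge k kN')); rewrite lerB//.
  rewrite (le_trans (ler_norm _))// normrM ler_piMr//.
  by rewrite ler_norml; lra.
have /andP[r0 r1] := rho01 k kN.
have d2r : d2 <= rho (x k) (x k.+1).
  rewrite -[leRHS]lnK ?posrE// ler_expR lerNl ler_pdivlMr// mulrC.
  by have := total k kN; rewrite -/(ell k); lra.
have -> : x k.+1 - x k = rho (x k) (x k.+1) * (1 - x k * x k.+1).
  by rewrite rhoE ?divfK ?gt_eqF ?rho_den_gt0//; apply: xs.
by rewrite ler_pM// ltW.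
Qed.

(** * Squeezing a block *)

Lemma pairsum_restrict {V : nmodType} (F : nat -> nat -> V) i j N :
  (i <= j)%N -> (j <= N)%N ->
  pairsum (fun k l => if (i <= k)%N && (l < j)%N then F k l else 0) 0 N =
  pairsum F i j.
Proof.
move=> ij jN; set F' := fun _ _ => _.
rewrite (pairsum_split _ 0 i N) ?(leq_trans ij)// (pairsum_split _ i j N) ?ij//.
have -> : pairsum F' 0 i = 0.
  rewrite (@eq_pairsum _ _ (fun _ _ => 0)) => [|k l _ kl li].
    by rewrite /pairsum big1// => l _; rewrite big1.
  by rewrite /F' leqNgt (ltn_trans kl li).
have -> : pairsum F' j N = 0.
  rewrite (@eq_pairsum _ _ (fun _ _ => 0)) => [|k l jk kl _].
    by rewrite /pairsum big1// => l _; rewrite big1.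
  by rewrite /F' ltnNge (leq_trans jk (ltnW kl)) andbF.
have -> : \sum_(i <= l < N) \sum_(0 <= k < i) F' k l = 0.
  rewrite big1// => l _; rewrite big_nat big1// => k /andP[_ ki].
  by rewrite /F' leqNgt ki.
have -> : \sum_(j <= l < N) \sum_(i <= k < j) F' k l = 0.
  rewrite big_nat big1// => l /andP[jl _]; rewrite big1// => k _.
  by rewrite /F' ltnNge jl andbF.
rewrite !addr0 add0r; apply: eq_pairsum => k l ik _ lj.
by rewrite /F' ik lj.
Qed.

(** All points stay in [0, 1 - 1 / N] whatever [eps], so that only the
interactions inside the contracted block can diverge as [eps] tends to 0. *)
Definition squeezed {R : realType} (N i j : nat) (eps : R) (k : nat) : R :=
  N%:R^-1 * (if (i <= k < j)%N then i%:R + eps * (k%:R - i%:R) else k%:R).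

Lemma squeezed_gap {R : realType} N i j (eps : R) k l : (0 < N)%N -> 
  0 < eps <= 1 -> (k < l)%N -> ~~ ((i <= k)%N && (l < j)%N) ->
  N%:R^-1 <= squeezed N i j eps l - squeezed N i j eps k.
Proof.
move=> N0 /andP[e0 e1] kl out.
have N1 : 0 < N%:R^-1 :> R by rewrite invr_gt0 ltr0n.
rewrite /squeezed -mulrBr ler_peMr ?(ltW N1)//.
have klR : k%:R + 1 <= l%:R :> R by rewrite natr1 ler_nat.
case: ifP => [/andP[il lj]|_]; case: ifP => [/andP[ik kj]|_].
- by rewrite ik lj in out.
- have ki : (k < i)%N by move: out; rewrite lj andbT -ltnNge.
  have : k%:R + 1 <= i%:R :> R by rewrite natr1 ler_nat.
  have : 0 <= eps * (l%:R - i%:R) by rewrite mulr_ge0 ?subr_ge0 ?ler_nat// ltW.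
  by lra.
- have : eps * (k%:R - i%:R) <= k%:R - i%:R.
    by rewrite ler_piMl// subr_ge0 ler_nat.
  by lra.
- by lra.
Qed.

Lemma squeezed_itv {R : realType} N i j (eps : R) k : (k < N)%N ->
  0 < eps <= 1 -> 0 <= squeezed N i j eps k <= 1 - N%:R^-1.
Proof.
move=> kN /andP[e0 e1].
have N0 : 0 < N%:R :> R by rewrite ltr0n; lia.
have N1 : 0 < N%:R^-1 :> R by rewrite invr_gt0.
have kNR : k%:R + 1 <= N%:R :> R by rewrite natr1 ler_nat.
suff h (y : R) : 0 <= y <= k%:R -> 0 <= N%:R^-1 * y <= 1 - N%:R^-1.
  rewrite /squeezed; case: ifP => [/andP[ik _]|_]; apply: h.
    have ik' : 0 <= k%:R - i%:R :> R by rewrite subr_ge0 ler_nat.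
    have := mulr_ge0 (ltW e0) ik'; have := ler_piMl ik' e1.
    by have := ler0n R i; lra.
  by rewrite lexx andbT.
move=> /andP[y0 yk]; rewrite mulr_ge0 ?(ltW N1)//=.
have yN : y + 1 <= N%:R by lra.
have := ler_wpM2l (ltW N1) yN; rewrite mulVf ?gt_eqF//.
by rewrite mulrDr mulr1 lerBrDr.
Qed.

Lemma squeezed_increasing {R : realType} N i j (eps : R) :
  0 < eps <= 1 -> increasing_in N (squeezed N i j eps).
Proof.
move=> e01; have /andP[e0 e1] := e01; split=> [k kN|k l kl lN].
  have := squeezed_itv N i j eps k kN e01.
  have : 0 < N%:R^-1 :> R by rewrite invr_gt0 ltr0n; lia.
  by lra.
have N1 : 0 < N%:R^-1 :> R by rewrite invr_gt0 ltr0n; lia.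
have [/andP[ik lj]|out] := boolP ((i <= k)%N && (l < j)%N).
  rewrite /squeezed ik lj (leq_trans ik (ltnW kl)) (ltn_trans kl lj)/=.
  by rewrite ltr_pM2l// ltrD2l ltr_pM2l// ltrD2r ltr_nat.
by rewrite -subr_gt0; apply: lt_le_trans (squeezed_gap _ _ _ _ _ _ _ _ kl out) => //; lia.
Qed.

(** Pairs inside the block have distances of order [expR (- t)], all others
stay at distance at least 1 / N; both estimates lose at most a factor N. *)
Lemma squeezed_interaction {R : realType} N i j (t : R) k l :
  0 <= t -> (k < l)%N -> (l < N)%N ->
  `|interaction (squeezed N i j (expR (- t)) k) (squeezed N i j (expR (- t)) l)
    - (if (i <= k)%N && (l < j)%N then t else 0)| <= ln N%:R + ln 2.
Proof.
move=> t0 kl lN; set eps := expR (- t).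
have e0 : 0 < eps := expR_gt0 _.
have e1 : eps <= 1 by rewrite -expR0 ler_expR oppr_le0.
have e01 : 0 < eps <= 1 by rewrite e0.
have N0 : 0 < N%:R :> R by rewrite ltr0n; exact: leq_ltn_trans lN.
have N1 : 1 <= N%:R :> R by rewrite ler1n -(ltr0n R).
have h0 : 0 < N%:R^-1 :> R by rewrite invr_gt0.
have [xb xs] := squeezed_increasing N i j eps e01.
have kN : (k < N)%N := ltn_trans kl lN.
have := rho_itv _ _ (xb k kN) (xb l lN) (xs k l kl lN).
have := interaction_bounds (squeezed N i j eps k) (squeezed N i j eps l).
have rE := rhoE _ _ (xs k l kl lN); rewrite rE.
have xk := squeezed_itv N i j eps k kN e01.
have xl := squeezed_itv N i j eps l lN e01.
have d0 := rho_den_gt0 _ _ (xb k kN) (xb l lN).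
have dh : N%:R^-1 <= 1 - squeezed N i j eps k * squeezed N i j eps l by nra.
have d1 : 1 - squeezed N i j eps k * squeezed N i j eps l <= 1 by nra.
have lnN : 0 <= ln N%:R :> R by rewrite ln_ge0.
have l2 : 0 <= ln 2 :> R by rewrite ln_ge0//; lra.
set D := 1 - _ in rE d0 dh d1 *.
set r := (_ - _) / D => I /andP[r0 r1].
have /andP[I1 I2] := I ltac:(by rewrite r0 ltW).
rewrite ler_norml.
case: ifPn => [/andP[ik lj]|out].
- have rE' : r = eps * (N%:R^-1 * (l%:R - k%:R) / D).
    rewrite /r /squeezed ik lj (leq_trans ik (ltnW kl)) (ltn_trans kl lj)/=.
    by ring.
  have klR : 1 <= l%:R - k%:R :> R by rewrite lerBrDl natr1 ler_nat.
  have klN : N%:R^-1 * (l%:R - k%:R) <= 1 :> R.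
    rewrite mulrC ler_pdivrMr// mul1r lerBlDr -natrD ler_nat.
    exact: leq_trans (ltnW lN) (leq_addr _ _).
  have up : r <= eps * N%:R.
    rewrite rE' ler_pM2l// ler_pdivrMr// (le_trans klN)//.
    by rewrite mulrC -ler_pdivrMr// mul1r.
  have lo : eps * N%:R^-1 <= r.
    rewrite rE' ler_pM2l// ler_pdivlMr//.
    rewrite (@le_trans _ _ N%:R^-1)//; first by rewrite ler_piMr// ltW.
    by rewrite ler_peMr// ltW.
  have lup : ln r <= - t + ln N%:R.
    by rewrite -[- t]expRK -lnM ?posrE// ler_ln ?posrE// mulr_gt0.
  have llo : - t - ln N%:R <= ln r.
    by rewrite -[- t]expRK -lnV ?posrE// -lnM ?posrE// ler_ln ?posrE// mulr_gt0.
  by lra.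
- have gap := squeezed_gap N i j eps k l (leq_ltn_trans (leq0n l) lN) e01 kl out.
  have lo : N%:R^-1 <= r.
    by rewrite /r ler_pdivlMr// (le_trans _ gap)// ler_piMr// ltW.
  have llo : - ln N%:R <= ln r by rewrite -lnV ?posrE// ler_ln ?posrE.
  have ln0 : ln r <= 0 by rewrite ln_le0// ltW.
  by lra.
Qed.

(** On the squeezed configurations the energy is - pi * t * S up to a
constant, where S > 0 is the pair sum of the block. *)
Lemma energy_unbounded {R : realType} N (c : R) e i j K :
  (i < j)%N -> (j <= N)%N ->
  0 < pairsum (fun k l => charge c e k * charge c e l) i j ->
  exists2 x, increasing_in N x & energy N c e x <= K.
Proof.
move=> ij jN S0; have pi0 := pi_gt0 R.
set S := pairsum _ i j in S0.
pose A := pairsum (fun k l => `|charge c e k * charge c e l|) 0 N.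
pose C : R := ln N%:R + ln 2.
pose G := \sum_(0 <= k < N) charge c e k ^+ 2.
(* The scale at which the bound of the energy drops below [K]. *)
pose t := Num.max 0 ((pi / 2 * (ln N%:R * G) + pi * (C * A) - K) / (pi * S)).
have t0 : 0 <= t by rewrite le_max lexx.
have tK : pi / 2 * (ln N%:R * G) + pi * (C * A) - K <= t * (pi * S).
  by rewrite -ler_pdivrMr ?mulr_gt0// le_max lexx orbT.
have e01 : 0 < expR (- t) <= 1.
  by rewrite expR_gt0 -expR0 ler_expR oppr_le0.
have N0 : 0 < N%:R :> R by rewrite ltr0n; lia.
have h0 : 0 < N%:R^-1 :> R by rewrite invr_gt0.
pose x := squeezed N i j (expR (- t)).
exists x; first exact: squeezed_increasing.
have pairs : t * S - C * A <= pairsum (fun k l => charge c e k * charge c e l *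
    interaction (x k) (x l)) 0 N.
  rewrite /S -(pairsum_restrict _ i j N (ltnW ij) jN) -!pairsumZ lerBlDr -pairsumD.
  apply: ler_pairsum => k l _ kl lN.
  rewrite -lerBlDl.
  have h := squeezed_interaction N i j t k l t0 kl lN.
  have -> : t * (if (i <= k)%N && (l < j)%N then charge c e k * charge c e l else 0) =
    charge c e k * charge c e l * (if (i <= k)%N && (l < j)%N then t else 0).
    by case: ifP => _; rewrite ?mulr0// mulrC.
  rewrite -mulrBr (le_trans (ler_norm _))// normrM mulrC ler_wpM2r//.
  by rewrite distrC.
have edge : - (ln N%:R * G) <=
    \sum_(0 <= k < N) charge c e k ^+ 2 * ln (2 - 2 * x k ^+ 2).
  rewrite -mulNr mulr_sumr big_nat [leRHS]big_nat; apply: ler_sum => k /andP[_ kN].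
  rewrite mulrC ler_wpM2l ?sqr_ge0//.
  have /andP[x0 x1] := squeezed_itv N i j (expR (- t)) k kN e01.
  have x2 : N%:R^-1 <= 2 - 2 * x k ^+ 2 by rewrite /x; nra.
  by rewrite -lnV ?posrE// ler_ln ?posrE//; lra.
rewrite /energy.
have := ler_wpM2l (ltW pi0) pairs.
have p2 : 0 <= pi / 2 :> R by lra.
by have := ler_wpM2l p2 edge; lra.
Qed.

(** * Continuity of W and existence of a minimiser *)

Lemma cvg_interaction {R : realType} {T : Type} (F : set_system T) (FF : Filter F)
    (f g : T -> R) (b c : R) : -1 < b < 1 -> -1 < c < 1 -> b != c ->
  f t @[t --> F] --> b -> g t @[t --> F] --> c ->
  interaction (f t) (g t) @[t --> F] --> interaction b c.
Proof.
move=> hb hc bc fb gc; have d0 := rho_den_gt0 _ _ hb hc.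
have rho0 : 0 < rho b c by rewrite divr_gt0// normr_gt0 subr_eq0.
have crho : rho (f t) (g t) @[t --> F] --> rho b c.
  apply: cvgM; first by apply: cvg_norm; exact: cvgB.
  apply: cvgV; first by rewrite gt_eqF.
  by apply: cvgB; [exact: cvg_cst|exact: cvgM].
rewrite /interaction; apply: continuous_cvg.
  apply: continuous_ln; apply: divr_gt0 => //.
apply: cvgM; last by apply: cvgV => //; rewrite gt_eqF.
apply: cvgD; first exact: cvg_cst.
apply: continuous_cvg; first exact: sqrt_continuous.
apply: cvgB; first exact: cvg_cst.
exact: (cvgM crho crho).
Qed.

Lemma cvg_W {R : realType} N alpha (a d : 'rV[R]_N) (F : set_system 'rV[R]_N)
    (FF : Filter F) :
  config R N a -> (forall i, (fun b : 'rV[R]_N => b 0 i) @ F --> a 0 i) ->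
  W alpha b d @[b --> F] --> W alpha a d.
Proof.
move=> [ab ai] coord.
have inj (k n : 'I_N) : k != n -> a 0 k != a 0 n.
  rewrite -val_eqE neq_ltn => /orP[kn|nk]; first by rewrite lt_eqF// ai.
  by rewrite gt_eqF// ai.
have sumc (I : finType) (P : pred I) (G : I -> 'rV[R]_N -> R) (l : I -> R) :
    (forall i, P i -> G i b @[b --> F] --> l i) ->
    \sum_(i | P i) G i b @[b --> F] --> \sum_(i | P i) l i.
  move=> h; apply: (@cvg_big R^o) => //.
  exact: (@pseudometric_normed_Zmodule.add_continuous _ R^o).
rewrite /W; apply: cvgB; apply: cvgM; try exact: cvg_cst.
- apply: sumc => n _; apply: cvgM; first exact: cvg_cst.
  apply: continuous_cvg.
    by apply: continuous_ln; have /andP[x1 x2] := ab n; nra.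
  apply: cvgB; first exact: cvg_cst.
  apply: cvgM; first exact: cvg_cst.
  exact: (cvgM (coord n) (coord n)).
- apply: (sumc _) => n _; apply: (sumc _) => k kn; apply: cvgM; first exact: cvg_cst.
  by apply: cvg_interaction => //; exact: inj.
Qed.

Lemma W_continuous {R : realType} N alpha (a d : 'rV[R]_N) :
  config R N a -> {for a, continuous (fun b => W alpha b d)}.
Proof.
move=> ha; apply: (cvg_W N alpha a d (nbhs a) (nbhs_filter a) ha) => i.
exact: coord_continuous.
Qed.

Definition margin_set (R : realType) N (delta : R) : set 'rV[R]_N :=
  [set a | (forall i, a 0 i \in `[- (1 - delta), 1 - delta]) /\
           (forall i j : 'I_N, (i < j)%N -> delta <= a 0 j - a 0 i)].

Lemma margin_set_compact {R : realType} N (delta : R) :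
  compact (margin_set R N delta).
Proof.
have -> : margin_set R N delta =
    [set a | forall i, `[- (1 - delta), 1 - delta]%classic (a 0 i)] `&`
    \bigcap_(ij in [set ij : 'I_N * 'I_N | (ij.1 < ij.2)%N])
      [set a | delta <= a 0 ij.2 - a 0 ij.1].
  apply/seteqP; split=> a [h1 h2]; split => //.
  - by move=> [i j] ij; exact: h2.
  - by move=> i j ij; exact: (h2 (i, j)).
apply: compact_closedI.
  apply: (@rV_compact _ N (fun=> `[- (1 - delta), 1 - delta]%classic)) => _.
  exact: segment_compact.
apply: closed_bigI => -[i j] _.
apply: (@closed_comp _ _ (fun a : 'rV[R]_N => a 0 j - a 0 i) [set y | delta <= y]).
  move=> a _; apply: (@continuousB _ R^o _ (fun b : 'rV[R]_N => b 0 j)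
    (fun b : 'rV[R]_N => b 0 i)); exact: coord_continuous.
exact: closed_ge.
Qed.

Lemma exists_config {R : realType} N : config R N !=set0.
Proof.
have e01 : 0 < (1 : R) <= 1 by rewrite ltr01 lexx.
have [xb xs] := squeezed_increasing N 0 N 1 e01.
exists (\row_i squeezed N 0 N 1 i); split=> [i|i j ij].
  by rewrite mxE; exact: xb.
by rewrite !mxE; exact: xs.
Qed.

(** A minimiser over a compact set that contains the sublevel set of some
configuration is a minimiser over all configurations. *)
Lemma W_minimiser {R : realType} N alpha e (d : 'rV[R]_N) :
  (2 <= N)%N -> `|cos alpha| < 1 -> (forall i, d 0 i = (-1) ^+ (i + e)) ->
  (forall i j, (i.+1 < j)%N -> (j <= N)%N ->
     pairsum (fun k l => charge (cos alpha) e k * charge (cos alpha) e l) i j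
     < 0) ->
  exists a : 'rV[R]_N, config R N a /\
    forall b : 'rV[R]_N, config R N b -> W alpha a d <= W alpha b d.
Proof.
case: N d => // N d N2 c1 de stable.
have [a0 ha0] := @exists_config R N.+1.
have [delta delta0 hdelta] :=
  sublevel_margin N.+1 (cos alpha) e (W alpha a0 d) N2 c1 stable.
have margin b : config R N.+1 b -> W alpha b d <= W alpha a0 d ->
    margin_set R N.+1 delta b.
  move=> [bb bi] Wb.
  pose x k := b 0 (inord k : 'I_N.+1).
  have bx i : b 0 i = x i by rewrite /x inord_val.
  have xN : increasing_in N.+1 x.
    by split=> [k _|k l kl lN]; [exact: bb|apply: bi; rewrite !inordK//; exact: ltn_trans lN].
  have [] := hdelta x xN.
    by rewrite -(W_energy _ _ _ b d).
  move=> h1 h2; split=> [i|i j ij]; last by rewrite !bx; apply: h2.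
  have := h1 i (ltn_ord i); rewrite bx in_itv/= -ler_norml; lra.
have sub : margin_set R N.+1 delta `<=` config R N.+1.
  move=> b [h1 h2]; split=> [i|i j ij].
    by have := h1 i; rewrite in_itv/= => /andP[? ?]; apply/andP; split; lra.
  by have := h2 i j ij; lra.
have cW : {within margin_set R N.+1 delta, continuous (fun b => W alpha b d)}.
  apply: continuous_in_subspaceT => b; rewrite inE => hb.
  by apply: W_continuous; exact: sub.
have [|a] := EVT_min_rV _ (margin_set_compact N.+1 delta) cW.
  by exists a0; exact: margin.
rewrite inE => ha amin; exists a; split; first exact: sub.
move=> b hb; have [Wb|/ltW Wb] := leP (W alpha b d) (W alpha a0 d).
  by apply: amin; rewrite inE; exact: margin.
by apply: le_trans Wb; apply: amin; rewrite inE; exact: margin.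
Qed.

Lemma W_unbounded {R : realType} N alpha e (d : 'rV[R]_N) i j :
  (forall i, d 0 i = (-1) ^+ (i + e)) -> (i < j)%N -> (j <= N)%N ->
  0 < pairsum (fun k l => charge (cos alpha) e k * charge (cos alpha) e l) i j ->
  ereal_inf [set (W alpha a d)%:E | a in config R N] = -oo%E.
Proof.
move=> de ij jN S0; apply: eq_ninfty => K; apply: ge_ereal_inf.
have [x [xb xs] xK] := energy_unbounded N (cos alpha) e i j K ij jN S0.
have ax (n : 'I_N) : (\row_m x m : 'rV[R]_N) 0 n = x n by rewrite mxE.
exists (W alpha (\row_m x m) d)%:E; last first.
  by rewrite lee_fin (W_energy _ _ _ _ _ _ ax de).
exists (\row_m x m) => //; split=> [n|n m nm]; first by rewrite ax; exact: xb.
by rewrite !ax; exact: xs.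
Qed.

Theorem proposition6 (R : realType) (alpha : R) (N : nat) (d : 'rV[R]_N)
    (halpha : 0 < alpha < pi) (hN : (2 <= N)%N)
    (hd : d = dplus R N \/ d = dminus R N) :
  let Th : set R := Theta N (d 0 (Ordinal (ltnW hN))) in
  (Th alpha ->
     exists a : 'rV[R]_N, config R N a /\
       forall b : 'rV[R]_N, config R N b -> W alpha a d <= W alpha b d) /\
  ((3 <= N)%N -> ~ closure Th alpha ->
     ereal_inf [set (W alpha a d)%:E | a in config R N] = -oo%E).
Proof.
have [e de] := alternating_signs N d hd.
have c1 : `|cos alpha| < 1.
  have /andP[a0 api] := halpha.
  have pi0 := pi_gt0 R; rewrite ltr_norml; apply/andP; split.
    by rewrite -cospi ltr_cos// in_itv/=; apply/andP; split; lra.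
  by rewrite -[ltRHS]cos0 ltr_cos// in_itv/=; apply/andP; split; lra.
rewrite de add0n; split=> [|N3].
- rewrite window_ThetaE// => bw; apply: (W_minimiser N alpha e) => // i j ij jN.
  have := window_stable (cos alpha) e N hN c1 bw i (j - i)%N.
  by rewrite subnKC; [apply; lia|lia].
- move=> /(not_closure_Theta N e alpha halpha) out.
  have [i [j [ij jN S0]]] := window_unstable (cos alpha) e N N3 c1 out.
  exact: W_unbounded S0.
Qed.
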